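(* If $G$ is a balanced Theta graph, then $\mathrm{mdim}(G)=4$.
   Context: All graphs are finite, simple and connected. $d(a,b)$ denotes the usual shortest-path distance between vertices $a,b$, and for a vertex $a$ and an edge $e=bc$ one sets $d(a,e)=\min\{d(a,b),d(a,c)\}$. A vertex $s\in V(G)$ distinguishes two distinct elements $x,x'\in V(G)\cup E(G)$ if $d(s,x)\neq d(s,x')$. A set $S\subseteq V(G)$ is a mixed metric generator of $G$ if every pair of distinct elements $x,x'\in V(G)\cup E(G)$ is distinguished by at least one vertex of $S$. The mixed metric dimension $\mathrm{mdim}(G)$ is the cardinality of a smallest mixed metric generator of $G$. A Theta graph is a graph with two vertices $u$ and $v$ of degree $3$, all other vertices being of degree $2$, consisting of three pairwise internally vertex-disjoint paths connecting $u$ and $v$. The length of a path is its number of edges. A Theta graph is balanced if the lengths of the three paths connecting $u$ and $v$ pairwise differ by at most $1$. *)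

(* Defs.v *)
From mathcomp Require Import all_boot.

Set Implicit Arguments.
Unset Strict Implicit.
Unset Printing Implicit Defensive.

Section Graph.

Variables (T : finType) (e : rel T).

Definition simple_graph := symmetric e /\ irreflexive e.

Definition connected_graph := forall x y : T, connect e x y.

Definition degree (x : T) : nat := #|[set y | e x y]|.

Definition edges : {set {set T}} :=
  [set f : {set T} | [exists x, exists y, e x y && (f == [set x; y])]].

Definition has_walk (x y : T) (n : nat) : bool :=
  [exists p : n.-tuple T, path e x p && (last x p == y)].

(* A shortest path has fewer than #|T| edges; the default #|T| is the value
   only when no path exists. *)
Definition dist (x y : T) : nat :=
  \big[minn/#|T|]_(n < #|T| | has_walk x y n) n.

(* The disjoint union of V(G) and E(G). *)
Definition element : finType := (T + {f : {set T} | f \in edges})%type.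

(* In a connected graph all distances are smaller than the default #|T|. *)
Definition dist_elt (s : T) (x : element) : nat :=
  match x with
  | inl y => dist s y
  | inr f => \big[minn/#|T|]_(y in val f) dist s y
  end.

Definition distinguishes (s : T) (x x' : element) : bool :=
  dist_elt s x != dist_elt s x'.

Definition mixed_metric_generator (S : {set T}) : bool :=
  [forall x : element, forall x' : element,
     (x != x') ==> [exists s in S, distinguishes s x x']].

(* The full vertex set of a connected simple graph is a generator, so the
   default #|T| does not affect the minimum. *)
Definition mdim : nat :=
  \big[minn/#|T|]_(S : {set T} | mixed_metric_generator S) #|S|.

(* As in MathComp's path.v, a path from u is given by u and the sequence p of
   its subsequent vertices; hence its number of edges is size p. *)
Definition simple_path (u v : T) (p : seq T) : bool :=
  [&& path e u p, last u p == v & uniq (u :: p)].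

Definition path_edges (u : T) (p : seq T) : seq {set T} :=
  [seq [set z.1; z.2] | z <- zip (u :: p) p].

Record theta_paths (u v : T) (P : 'I_3 -> seq T) : Prop := ThetaPaths {
  theta_neq : u != v;
  theta_deg_u : degree u = 3;
  theta_deg_v : degree v = 3;
  theta_deg_other : forall x, x != u -> x != v -> degree x = 2;
  theta_path : forall i, simple_path u v (P i);
  theta_disjoint : forall i j x, i != j ->
    x \in u :: P i -> x \in u :: P j -> x \in [:: u; v];
  theta_vertices : forall x, exists i, x \in u :: P i;
  theta_edges : forall f, f \in edges -> exists i, f \in path_edges u (P i)
}.

(* The branch vertices and the three paths of a Theta graph are unique up to
   exchange and reordering, so their choice is immaterial. *)
Definition balanced_theta_graph :=
  exists (u v : T) (P : 'I_3 -> seq T),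
    theta_paths u v P /\ forall i j, size (P i) <= (size (P j)).+1.

End Graph.

(* Main.v *)
Require Import Defs.
From mathcomp Require Import all_boot all_order zify.

(** Let the three paths have lengths [m] or [m.+1], [m] being attained.

    Distances. Write [pt i k] for the vertex reached from [u] by [k] steps
    along path [i]. Balance makes every path almost a geodesic: the detour
    through another path shortens no distance between two vertices of the same
    path, except that it makes the distance of [u] and [v] equal to [m]. So
    the distance from [pt j p] to [pt i k] is a minimum of at most three
    explicit lengths, [ptdist j p i k]. This is checked with [dist_potential]:
    a function that vanishes at the source, changes by at most one along an
    edge and has a descending neighbour everywhere else is the distance.

    Upper bound. Take [u], [v] and the neighbours of [u] on the two paths
    other than a shortest one, [k]. The distances to [u] and [v] nearly give
    the position of an element along its path. The neighbour of [u] on path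
    [a] is closer to an element of [a] than to an element at the same position
    of another path, and so separates [a] from the other two paths, up to the
    vertices [u] and [v], which lie on all paths ([sensors_generate]).

    Lower bound. Call the elements of a generator sensors. A vertex [x] and an
    edge [xy] are distinguished by [s] exactly when [y] is closer to [s] than
    [x] is, so for every vertex and every edge at it there must be a sensor to
    which that edge leads. At [u], the first edge of path [i] leads only to
    inner vertices of path [i], and to [v] if path [i] is shortest; likewise
    at [v]. If some path had no sensor inside it, then [u] and [v] would be
    sensors, and at most one more would be left; so a second path would have
    no inner sensor either, both would be shortest, and exchanging them would
    move no sensor. Thus a generator with at most three elements has exactly
    one sensor inside each path ([generator_meets_paths]). Let [a], [b], [c]
    order the paths by the offset of their sensor from the middle, towards
    [v]. The edge at the sensor of [a] towards [v] and the one at the sensor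
    of [c] towards [u] force these two sensors to be antipodal on the cycle
    formed by [a] and [c]. The reflection of this cycle that fixes both
    sensors does not change the distances to them; as the offset of the third
    sensor lies between theirs, some vertex or edge has the same distance to
    it as its mirror image ([mirror_pair]). *)

Set Implicit Arguments.
Unset Strict Implicit.
Unset Printing Implicit Defensive.

(** * Minima, sets and lists *)

Lemma leq_bigminn (I : finType) (A : pred I) (F : I -> nat) d n :
  n <= d -> (forall i, A i -> n <= F i) -> n <= \big[minn/d]_(i | A i) F i.
Proof. by rewrite -minEnat -!leEnat; apply: Order.POrderTheory.le_bigmin. Qed.

Lemma bigminn_leq (I : finType) (A : pred I) (F : I -> nat) d i :
  A i -> \big[minn/d]_(j | A j) F j <= F i.
Proof. by rewrite -minEnat -leEnat; apply: Order.TotalTheory.bigmin_le_cond. Qed.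

Lemma set2_inj (T : finType) (x y a b : T) : x != y -> [set x; y] = [set a; b] ->
  (x = a /\ y = b) \/ (x = b /\ y = a).
Proof.
move=> neq_xy eq_s.
have := set21 x y; have := set22 x y; rewrite eq_s !inE.
by case/orP=> /eqP ?; case/orP=> /eqP ?; subst; rewrite ?eqxx in neq_xy; auto.
Qed.

Lemma uniq_leq_card (T : finType) (S : {set T}) (s : seq T) :
  uniq s -> {subset s <= S} -> size s <= #|S|.
Proof. by move=> /card_uniqP <- sS; apply/subset_leq_card/subsetP. Qed.

Lemma sort3 (g : 'I_3 -> nat) :
  exists a b c : 'I_3, [/\ uniq [:: a; b; c], g a <= g b & g b <= g c].
Proof.
pose s := sort (relpre g leq) (enum 'I_3).
have s_sorted : sorted (relpre g leq) s.
  by apply: sort_sorted => i j; apply: leq_total.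
have s_uniq : uniq s by rewrite sort_uniq enum_uniq.
have : size s = 3 by rewrite size_sort size_enum_ord.
case: s s_sorted s_uniq => [|a [|b [|c []]]] //= /and3P[le_ab le_bc _] abc _.
by exists a, b, c.
Qed.

(** * Distances as potentials *)

(** Going down the potential from [y] gives a walk to the source of length
    [f y].  Its vertices have distinct potentials, so it is short enough to be
    seen by [dist], whose walks have fewer than [#|T|] edges. *)
Lemma dist_potential (T : finType) (e : rel T) (f : T -> nat) (s : T) :
    f s = 0 -> (forall x y, e x y -> f y <= (f x).+1) ->
    (forall y, y != s -> exists2 x, e x y & f x < f y) ->
  forall y, dist e s y = f y /\ f y < #|T|.
Proof.
move=> fs0 f_lip f_desc y.
have f_walk p : forall x, path e x p -> f (last x p) <= f x + size p.
  elim: p => [|z p IH] x /=; first by rewrite addn0.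
  by case/andP=> /f_lip le_fz /IH; lia.
have [p [e_p last_p Up le_p] size_p]: exists2 p,
    [/\ path e s p, last s p = y, uniq (s :: p) & {in s :: p, forall z, f z <= f y}]
    & size p = f y.
  have [n] := ubnP (f y); elim: n => // n IH in y * => lt_fy.
  have [->|/f_desc[x exy lt_fx]] := eqVneq y s.
    by exists [::]; [split=> // z; rewrite inE => /eqP-> | rewrite fs0].
  have [|p [e_p last_p Up le_p] size_p] := IH x; first by lia.
  have fyE : f y = (f x).+1 by have := f_lip _ _ exy; lia.
  exists (rcons p y); last by rewrite size_rcons size_p fyE.
  split=> [||| z]; rewrite ?last_rcons //.
  - by rewrite rcons_path e_p last_p.
  - rewrite -rcons_cons rcons_uniq Up andbT; apply/negP=> /le_p; lia.
  - rewrite -rcons_cons mem_rcons inE => /predU1P[->//|/le_p]; lia.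
have lt_fy : f y < #|T|.
  by rewrite -size_p -[_.+1]/(size (s :: p)) -(card_uniqP Up) max_card.
split=> //; apply/anti_leq/andP; split; last first.
  apply: leq_bigminn => [|n /existsP[q /andP[/f_walk le_f /eqP last_q]]]; first exact: ltnW.
  by move: le_f; rewrite last_q fs0 size_tuple.
apply: (@bigminn_leq _ _ _ _ (Ordinal lt_fy)); apply/existsP.
by exists (Tuple (introT eqP size_p)); rewrite /= e_p last_p eqxx.
Qed.

(** * Arithmetic of positions on the paths *)

(** The distance between the positions [p] and [k] on one path. *)
Definition along p k := (k - p) + (p - k).

(** The distance from position [p] inside a path of length [l] to position [k]
    on another path of length [l']: the shorter of the routes through [u] and
    through [v]. *)
Definition around l p l' k := minn (p + k) (l - p + (l' - k)).

Lemma around_up l p l' k :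
  around l p l' k.+1 < around l p l' k -> p < l -> k < l' -> l' + l <= k.*2 + p.*2.
Proof. rewrite /around; lia. Qed.

Lemma around_down l p l' k :
  around l p l' k < around l p l' k.+1 -> p < l -> k < l' -> k.+1.*2 + p.*2 <= l' + l.
Proof. rewrite /around; lia. Qed.

(** Two paths of length [l] form a cycle, on which the sensors at [pa] and [pc]
    are antipodal when [pa + pc = l].  Position [t] on the path of [pc] and
    position [pa + t + pa] on the path of [pa] are mirror images in the axis
    through these sensors, and equally far from each of them.  Let a vertex move
    along the path of [pc] from [u] to the mirror image of [v].  By the two
    inequalities, the distance of the third sensor [pb] to this vertex is at most
    that to its mirror image at the start, and at least that at the end.  The
    difference grows by two at each step; so it vanishes at a vertex if [l = lb],
    and in the middle of an edge otherwise.  The boolean [r] tells which; the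
    element concerned extends from [t] to [t + r]. *)
Lemma mirror_pair m l lb pa pb pc :
    m <= l <= m.+1 -> m <= lb <= m.+1 ->
    0 < pa < l -> 0 < pb < lb -> 0 < pc < l -> pa + pc = l ->
    pa.*2 + lb <= pb.*2 + l -> pb.*2 + l <= pc.*2 + lb ->
  exists t t' (r : bool), [/\ t + r < l, 0 < t', t' + r <= l &
    [/\ minn (around l pa l t) (around l pa l (t + r)) =
        minn (along pa t') (along pa (t' + r)),
      minn (around lb pb l t) (around lb pb l (t + r)) =
        minn (around lb pb l t') (around lb pb l (t' + r)) &
      minn (along pc t) (along pc (t + r)) =
        minn (around l pc l t') (around l pc l (t' + r))]].
Proof.
move=> Bl Blb pa_in pb_in pc_in eq_ac le_ab le_bc; rewrite /along /around.
have [lt_lb|lt_bl|eq_l] := ltngtP l lb.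
- have [t pcE] : exists t, pc = t + pb by exists (pc - pb); lia.
  have lbE : lb = l.+1 by lia.
  exists t, (pa + t + pa), true; rewrite !addn1; clear Bl Blb lt_lb; subst lb l pc.
  by split; [lia | lia | lia | split; lia].
- have [t pcE] : exists t, pc = t + pb.+1 by exists (pc - pb.+1); lia.
  have lbE : l = lb.+1 by lia.
  have {lbE} lbE : lb = pa + t + pb by lia.
  exists t, (pa + t + pa), true; rewrite !addn1; clear Bl Blb lt_bl; subst l lb pc.
  by split; [lia | lia | lia | split; lia].
have [t pcE] : exists t, pc = t + pb by exists (pc - pb); lia.
exists t, (pa + t + pa), false; rewrite !addn0 !minnn; clear Bl Blb; subst lb l pc.
by split; [lia | lia | lia | split; lia].
Qed.

Lemma elt_from_u m l x (r : bool) : l <= m.+1 -> x + r <= l ->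
  minn (minn x m) (minn (x + r) m) = if r then x else minn x m.
Proof. by case: r; rewrite ?addn1 ?addn0 ?minnn //; lia. Qed.

Lemma elt_from_v m l x (r : bool) : l <= m.+1 -> x + r <= l ->
  minn (minn (l - x) m) (minn (l - (x + r)) m)
    = if r then l - x.+1 else minn (l - x) m.
Proof. by case: r; rewrite ?addn1 ?addn0 ?minnn //; lia. Qed.

Lemma elt_along1 x (r : bool) :
  minn (along 1 x) (along 1 (x + r)) = if r then x.-1 else along 1 x.
Proof. by rewrite /along; case: r; rewrite ?addn1 ?addn0 ?minnn //; lia. Qed.

Lemma elt_around l p l' k (r : bool) :
  minn (around l p l' k) (around l p l' (k + r))
    = minn (p + k) (l - p + (l' - (k + r))).
Proof. by rewrite /around; case: r; rewrite ?addn1 ?addn0 ?minnn //; lia. Qed.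

(** On one path the distances to [u] and [v] add up to its length at a vertex
    and to one less at an edge; the only exceptions, on a long path, are its
    end vertices, which the sensor next to [u] tells from the edges at them. *)
Lemma sensors_along m l x y (r r' : bool) :
    0 < m -> m <= l <= m.+1 -> x + r <= l -> y + r' <= l ->
    minn (minn x m) (minn (x + r) m) = minn (minn y m) (minn (y + r') m) ->
    minn (minn (l - x) m) (minn (l - (x + r)) m)
      = minn (minn (l - y) m) (minn (l - (y + r')) m) ->
    l = m \/
    minn (along 1 x) (along 1 (x + r)) = minn (along 1 y) (along 1 (y + r')) ->
  x = y /\ r = r'.
Proof.
move=> m_gt0 /andP[ge_lm le_lm] le_x le_y.
rewrite (elt_from_u le_lm le_x) (elt_from_v le_lm le_x).
rewrite (elt_from_u le_lm le_y) (elt_from_v le_lm le_y) !elt_along1 /along.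
case: r r' le_x le_y => [] [] le_x le_y; rewrite ?addn1 ?addn0 in le_x le_y;
  by move=> Eu Ev [lm|Ew]; lia.
Qed.

(** The sensor next to [u] on the path of length [la] tells that path from the
    others, except at its end vertices, which also lie on the other path. *)
Lemma sensors_around m la lb x y (r r' : bool) :
    0 < m -> m <= la <= m.+1 -> 1 < la -> m <= lb <= m.+1 ->
    x + r <= la -> y + r' <= lb ->
    minn (minn x m) (minn (x + r) m) = minn (minn y m) (minn (y + r') m) ->
    minn (minn (la - x) m) (minn (la - (x + r)) m)
      = minn (minn (lb - y) m) (minn (lb - (y + r')) m) ->
    minn (along 1 x) (along 1 (x + r)) =
      minn (around la 1 lb y) (around la 1 lb (y + r')) ->
  r = false /\ (x = 0 \/ x = la).
Proof.
move=> m0 /andP[ge_am le_am] la1 /andP[ge_bm le_bm] le_x le_y.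
rewrite (elt_from_u le_am le_x) (elt_from_v le_am le_x).
rewrite (elt_from_u le_bm le_y) (elt_from_v le_bm le_y).
rewrite !elt_along1 elt_around /along.
case: r r' le_x le_y => [] [] le_x le_y; rewrite ?addn1 ?addn0 in le_x le_y *;
  move=> Eu Ev Ew.
- by lia.
- by lia.
- by split=> //; lia.
- by split=> //; lia.
Qed.

(** * Coordinates on a Theta graph *)

Section Theta.

Variables (T : finType) (e : rel T) (u v : T) (P : 'I_3 -> seq T).
Hypothesis e_simple : simple_graph e.
Hypothesis theta : theta_paths e u v P.

Let L i := size (P i).

Definition pt (i : 'I_3) (k : nat) : T := nth v (u :: P i) k.

Lemma pt0 i : pt i 0 = u. Proof. by []. Qed.

Lemma ptL i : pt i (L i) = v.
Proof.
have /and3P[_ /eqP last_p _] := theta_path theta i.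
by rewrite /pt -[X in nth _ _ X]/((size (u :: P i)).-1) nth_last.
Qed.

Lemma pt_adj i k : k < L i -> e (pt i k) (pt i k.+1).
Proof.
by have /and3P[/(pathP v) ep _ _] := theta_path theta i => /ep.
Qed.

Lemma mem_pt i k : k <= L i -> pt i k \in u :: P i.
Proof. by move=> le_k; apply: mem_nth. Qed.

Lemma pt_inj_path i k l : k <= L i -> l <= L i -> pt i k = pt i l -> k = l.
Proof.
move=> le_k le_l /eqP; have /and3P[_ _ Up] := theta_path theta i.
by rewrite nth_uniq // => /eqP.
Qed.

Lemma length_gt0 i : 0 < L i.
Proof.
rewrite lt0n; apply/negP=> /eqP L0; have := ptL i; rewrite L0 pt0.
by move/eqP; apply/negP; apply: theta_neq theta.
Qed.

Lemma pt_inj i k j l : k <= L i -> l <= L j -> pt i k = pt j l ->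
  [\/ i = j /\ k = l, k = 0 /\ l = 0 | k = L i /\ l = L j].
Proof.
move=> le_k le_l eq_pt; have [eq_ij|neq_ij] := eqVneq i j.
  by subst j; constructor 1; split=> //; apply: pt_inj_path le_k le_l eq_pt.
have := theta_disjoint theta neq_ij (mem_pt le_k); rewrite eq_pt => /(_ (mem_pt le_l)).
rewrite !inE => /orP[]/eqP pE; [constructor 2 | constructor 3].
  by split; [apply: (@pt_inj_path i) | apply: (@pt_inj_path j)]; rewrite // ?eq_pt ?pE.
by split; [apply: (@pt_inj_path i) | apply: (@pt_inj_path j)];
  rewrite // ?eq_pt ?pE ?ptL.
Qed.

Lemma pt_neq i j k l : i != j -> 0 < k < L i -> l <= L j -> pt i k != pt j l.
Proof.
move=> neq_ij /andP[k_gt0 lt_k] le_l; apply/eqP=> /(pt_inj (ltnW lt_k) le_l)[].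
- by case=> eq_ij; rewrite eq_ij eqxx in neq_ij.
- by case=> k0; rewrite k0 in k_gt0.
- by case=> kL; rewrite kL ltnn in lt_k.
Qed.

Lemma inner_neq i k : 0 < k < L i -> (pt i k != u) /\ (pt i k != v).
Proof.
move=> /andP[k_gt0 lt_k]; split; apply/eqP.
  by rewrite -(pt0 i) => /(pt_inj_path (ltnW lt_k) (leq0n _)); lia.
by rewrite -{1}(ptL i) => /(pt_inj_path (ltnW lt_k) (leqnn _)); lia.
Qed.

Lemma pt_surj x : exists i k, k <= L i /\ x = pt i k.
Proof.
have [i xi] := theta_vertices theta x; exists i, (index x (u :: P i)).
by split; [move: xi; rewrite -index_mem ltnS | rewrite /pt nth_index].
Qed.

Lemma edge_pt f : f \in edges e ->
  exists i k, k < L i /\ f = [set pt i k; pt i k.+1].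
Proof.
case/(theta_edges theta)=> i /mapP[z /(nthP (v, v))[k lt_k <-] ->].
exists i, k; rewrite nth_zip_cond lt_k.
by split=> //; move: lt_k; rewrite size_zip /= /L; lia.
Qed.

Lemma edges_pt i k : k < L i -> [set pt i k; pt i k.+1] \in edges e.
Proof.
move=> lt_k; rewrite inE; apply/existsP; exists (pt i k).
by apply/existsP; exists (pt i k.+1); rewrite pt_adj ?eqxx.
Qed.

Lemma adj_pt x y : e x y -> exists i k, k < L i /\
  ((x = pt i k /\ y = pt i k.+1) \/ (x = pt i k.+1 /\ y = pt i k)).
Proof.
move=> exy.
have [i [k [lt_k fE]]] : exists i k, k < L i /\ [set x; y] = [set pt i k; pt i k.+1].
  apply: edge_pt; rewrite inE; apply/existsP; exists x; apply/existsP; exists y.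
  by rewrite exy eqxx.
exists i, k; split=> //; apply: set2_inj fE.
by apply: contraTneq exy => ->; rewrite e_simple.2.
Qed.

(** Two paths of length one would share their edge, which would leave [u] with
    degree at most two. *)
Lemma length1_uniq i j : L i = 1 -> L j = 1 -> i = j.
Proof.
move=> Li Lj; apply/eqP; apply: contraT => neq_ij.
have : degree e u <= #|[set pt k 1 | k in [set~ i]]|.
  apply: subset_leq_card; apply/subsetP=> y; rewrite inE => /adj_pt[k [l [lt_l pE]]].
  have yE: y = pt k 1.
    case: pE => [] [uE yE]; move: uE; rewrite -(pt0 k).
      by move/(pt_inj_path (leq0n _) (ltnW lt_l)); rewrite yE => <-.
    by move/(pt_inj_path (leq0n _) lt_l).
  have [eq_ki|neq_ki] := eqVneq k i; last by rewrite yE imset_f // !inE.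
  have -> : y = pt j 1 by rewrite yE eq_ki -{1}Li -Lj !ptL.
  by rewrite imset_f // !inE eq_sym.
rewrite (theta_deg_u theta); apply: contraTT => _; rewrite -ltnNge.
by apply: leq_ltn_trans (leq_imset_card _ _) _; rewrite cardsC1 card_ord.
Qed.

(** * Distances in a balanced Theta graph *)

Variable m : nat.
Hypothesis L_bounds : forall i, m <= L i <= m.+1.
Hypothesis L_short : exists i, L i = m.

(** The minima with [m] are the distances from [pt j p] to [u] and to [v].  They
    differ from [p] and [L j - p] only if [L j = m.+1] and [pt j p] is [u] or
    [v]. *)
Definition ptdist j p i k :=
  let far := minn (minn p m + k) (minn (L j - p) m + (L i - k)) in
  if i == j then minn far (along p k) else far.

Lemma ptdist_u j i k : ptdist j 0 i k = minn k m.
Proof.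
rewrite /ptdist /along.
by case: eqP => [->|_]; have := L_bounds i; have := L_bounds j; lia.
Qed.

Lemma ptdist_v j i k : k <= L i -> ptdist j (L j) i k = minn (L i - k) m.
Proof.
rewrite /ptdist /along.
by case: eqP => [->|_]; have := L_bounds i; have := L_bounds j; lia.
Qed.

Lemma ptdist_along j p k : 0 < p < L j -> k <= L j -> ptdist j p j k = along p k.
Proof.
by move=> p_in le_k; rewrite /ptdist /along eqxx; have := L_bounds j; lia.
Qed.

Lemma ptdist_around j p i k : 0 < p < L j -> j != i ->
  ptdist j p i k = around (L j) p (L i) k.
Proof.
move=> p_in /negPf neq_ji; rewrite /ptdist /around eq_sym neq_ji.
by have := L_bounds j; lia.
Qed.

Lemma ptdist0 j p i : p <= L j -> ptdist j p i 0 = minn p m.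
Proof.
move=> le_p; rewrite /ptdist /along.
by case: eqP => [->|_]; have := L_bounds i; have := L_bounds j; lia.
Qed.

Lemma ptdistL j p i : p <= L j -> ptdist j p i (L i) = minn (L j - p) m.
Proof.
move=> le_p; rewrite /ptdist /along.
by case: eqP => [->|_]; have := L_bounds i; have := L_bounds j; lia.
Qed.

Lemma ptdist_lip j p i k : p <= L j -> k < L i ->
  ptdist j p i k <= (ptdist j p i k.+1).+1 /\ ptdist j p i k.+1 <= (ptdist j p i k).+1.
Proof.
move=> le_p lt_k; rewrite /ptdist /along.
move: (minn p m) (minn (L j - p) m) => a b.
by case: eqP => [eq_ij|_]; lia.
Qed.

Lemma dist_pt_lt j p i k : p <= L j -> k <= L i ->
  dist e (pt j p) (pt i k) = ptdist j p i k /\ ptdist j p i k < #|T|.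
Proof.
move=> le_p le_k.
(* The formula depends on coordinates; [u] and [v] have three pairs of them, on
   which it agrees, so that it defines a function [f] of the vertex. *)
have coordP x : exists i, x \in u :: P i by apply: theta_vertices theta x.
pose c x := xchoose (coordP x).
pose f x := ptdist j p (c x) (index x (u :: P (c x))).
have f_pt i1 k1 : k1 <= L i1 -> f (pt i1 k1) = ptdist j p i1 k1.
  move=> le_k1; have := xchooseP (coordP (pt i1 k1)); rewrite -/(c _) /f.
  set i2 := c _; set k2 := index _ _ => in_c.
  have le_k2 : k2 <= L i2 by move: in_c; rewrite -index_mem ltnS.
  have : pt i2 k2 = pt i1 k1 by rewrite /k2 /pt nth_index.
  case/pt_inj => // [[-> ->]|[-> ->]|[-> ->]] //; first by rewrite !ptdist0.
  by rewrite !ptdistL.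
rewrite -f_pt //; apply: dist_potential => [||y neq_y].
- by rewrite f_pt // /ptdist /along eqxx; lia.
- move=> x y /adj_pt[i1 [k1 [lt_k1]]] [] [-> ->]; rewrite !f_pt //; try exact: ltnW.
    by case: (ptdist_lip le_p lt_k1).
  by case: (ptdist_lip le_p lt_k1).
have [i1 [k1 [le_k1 yE]]] := pt_surj y; subst y.
have step a l l' : pt i1 k1 = pt a l -> l <= L a -> l' <= L a ->
    (l = l'.+1) \/ (l' = l.+1) -> ptdist j p a l' < ptdist j p a l ->
    exists2 x, e x (pt i1 k1) & f x < f (pt i1 k1).
  move=> -> le_l le_l' adj_l lt_d; exists (pt a l'); last by rewrite !f_pt.
  by case: adj_l => lE; subst; [|rewrite e_simple.1]; apply: pt_adj.
case: L_short => i0 Li0.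
have B1 := L_bounds i1; have Bj := L_bounds j; have i0_gt0 := length_gt0 i0.
have [k10|k1_gt0] := posnP k1; last have [k1L|k1_ltL] := eqVneq k1 (L i1).
(* From [u] the way leads along path [j], unless the source is [v] and path [j]
   is long; then it leads along a shortest path. *)
- subst k1; have p_gt0 : 0 < p.
    by rewrite lt0n; apply: contra_neq neq_y => ->; rewrite !pt0.
  have [le_pm|lt_mp] := leqP p m.
    by apply: (step j 0 1); rewrite ?pt0 /ptdist /along ?eqxx //; lia.
  have pE : p = L j by lia.
  by apply: (step i0 0 1); rewrite ?pt0 // ?pE ?ptdist_v ?Li0 //; lia.
- subst k1; have p_ltL : p < L j.
    by rewrite ltn_neqAle le_p andbT; apply: contra_neq neq_y => ->; rewrite !ptL.
  have [le_pm|lt_mp] := leqP (L j - p) m.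
    by apply: (step j (L j) (L j).-1); rewrite ?ptL /ptdist /along ?eqxx //; lia.
  have pE : p = 0 by lia.
  by apply: (step i0 (L i0) (L i0).-1); rewrite ?ptL // ?pE ?ptdist_u ?Li0 //; lia.
have lt_or : ptdist j p i1 k1.-1 < ptdist j p i1 k1 \/ ptdist j p i1 k1.+1 < ptdist j p i1 k1.
  rewrite /ptdist /along; case: eqP => [eq_ij|_]; last by lia.
  have neq_kp : k1 <> p.
    by move=> eq_kp; move: neq_y; rewrite eq_ij eq_kp eqxx.
  subst i1; move: (minn p m) (minn (L j - p) m) => a b.
  have [le_a|lt_a] := leqP (a + k1) (minn (b + (L j - k1)) (k1 - p + (p - k1))).
    by left; clear -le_a k1_gt0 k1_ltL le_k1; lia.
  have [le_b|lt_b] := leqP (b + (L j - k1)) (k1 - p + (p - k1)); first by right; lia.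
  by case: (ltnP k1 p) => cmp_kp; [right | left]; lia.
by case: lt_or => lt_d; [apply: (step i1 k1 k1.-1) | apply: (step i1 k1 k1.+1)] => //; lia.
Qed.

Lemma dist_pt j p i k : p <= L j -> k <= L i -> dist e (pt j p) (pt i k) = ptdist j p i k.
Proof. by move=> le_p le_k; case: (dist_pt_lt le_p le_k). Qed.

(** Vertices and edges are treated alike: an element occupies the positions
    from [k] to [k + r] of path [i]. *)
Definition located (z : element e) i k (r : bool) :=
  k + r <= L i /\
  match z with
  | inl x => r = false /\ x = pt i k
  | inr f => r = true /\ val f = [set pt i k; pt i k.+1]
  end.

Definition edge_elt i k (lt_k : k < L i) : element e :=
  inr (exist (fun f => f \in edges e) [set pt i k; pt i k.+1] (edges_pt lt_k)).

Lemma located_vertex i k : k <= L i -> located (inl (pt i k)) i k false.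
Proof. by rewrite /located addn0. Qed.

Lemma located_edge i k (lt_k : k < L i) : located (edge_elt lt_k) i k true.
Proof. by rewrite /located addn1. Qed.

Lemma located_surj z : exists i k r, located z i k r.
Proof.
case: z => [x|[f edge_f]].
  have [i [k [le_k xE]]] := pt_surj x.
  by exists i, k, false; rewrite /located addn0.
have [i [k [lt_k fE]]] := edge_pt edge_f.
by exists i, k, true; rewrite /located addn1.
Qed.

Lemma located_ex i k (r : bool) : k + r <= L i -> exists z, located z i k r.
Proof.
case: r; rewrite ?addn1 ?addn0 => le_k; first by exists (edge_elt le_k); apply: located_edge.
by exists (inl (pt i k)); apply: located_vertex.
Qed.

Lemma located_inj z z' i k r : located z i k r -> located z' i k r -> z = z'.
Proof.
case=> _; case: z => [x|f] [-> zE]; case=> _; case: z' => [x'|f'] [] //.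
  by move=> _ ->; rewrite zE.
by move=> _ zE'; congr inr; apply/val_inj; rewrite zE zE'.
Qed.

(** Since [u] and [v] lie on every path, comparing them with an element of
    another path reduces to comparing two elements of one path. *)
Lemma located_ends z i j k : located z i k false -> k = 0 \/ k = L i ->
  exists l, located z j l false.
Proof.
case=> _; case: z => [x|f] [] // _ -> [] ->; [exists 0 | exists (L j)].
  by rewrite pt0 -(pt0 j); apply: located_vertex.
by rewrite ptL -(ptL j); apply: located_vertex.
Qed.

Lemma located_inner z i j k l (r r' : bool) : i != j -> k + r < L i -> 0 < l ->
  located z i k r -> ~ located z j l r'.
Proof.
move=> neq_ij lt_k l_gt0 [_ zE] [le_l zE'].
have le_l0 : l <= L j by apply: leq_trans (leq_addr _ _) le_l.
have neq_pt k1 l1 : k1 < L i -> 0 < l1 -> l1 <= L j -> pt i k1 <> pt j l1.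
  move=> lt_k1 l1_gt0 le_l1 /(pt_inj (ltnW lt_k1) le_l1)[].
  - by case=> eq_ij; rewrite eq_ij eqxx in neq_ij.
  - by case=> _ l10; rewrite l10 in l1_gt0.
  - by case=> k1L; rewrite k1L ltnn in lt_k1.
case: z zE zE' => [x|f] [rE zE] [rE' zE']; subst r r'.
  by rewrite addn0 in lt_k; apply: (neq_pt k l); rewrite -?zE -?zE'.
rewrite addn1 in lt_k le_l *; have := set21 (pt i k) (pt i k.+1).
rewrite -zE zE' !inE => /orP[]/eqP; apply: neq_pt => //; rewrite ?addn1 // in le_l *.
  exact: ltn_trans lt_k.
exact: ltn_trans lt_k.
Qed.

Definition eltdist j p i k (r : bool) := minn (ptdist j p i k) (ptdist j p i (k + r)).

Lemma dist_elt_located j p z i k r : p <= L j -> located z i k r ->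
  dist_elt (pt j p) z = eltdist j p i k r.
Proof.
move=> le_p [le_kr]; rewrite /eltdist; case: z => [x|f] [rE zE]; subst r.
  by rewrite addn0 minnn /= zE dist_pt // -[k]addn0.
rewrite addn1 in le_kr *.
have [Dk ltk] := dist_pt_lt le_p (ltnW le_kr); have [Dk1 ltk1] := dist_pt_lt le_p le_kr.
rewrite /= zE -Dk -Dk1; apply/anti_leq/andP; split.
  by rewrite leq_min !bigminn_leq // !inE eqxx ?orbT.
apply: leq_bigminn => [|y]; first by rewrite Dk geq_min ltnW.
by rewrite !inE => /orP[]/eqP->; rewrite ?geq_minl ?geq_minr.
Qed.

(** * A generator with four elements *)

Lemma sensors_generate (S : {set T}) k : L k = m -> u \in S -> v \in S ->
  (forall a, a != k -> pt a 1 \in S) -> mixed_metric_generator e S.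
Proof.
move=> Lk uS vS wS.
have m_gt0 : 0 < m by rewrite -Lk length_gt0.
have L_gt1 a : a != k -> 1 < L a.
  move=> neq_ak; have := length_gt0 a; rewrite leq_eqVlt => /predU1P[La|//].
  have := L_bounds a; rewrite -La => /andP[le_m1 _].
  by case/eqP: neq_ak; apply: length1_uniq; lia.
pose same (z z' : element e) := forall s, s \in S -> dist_elt s z = dist_elt s z'.
have same_eltdist z z' a b x y r r' : located z a x r -> located z' b y r' -> same z z' ->
    forall j p, p <= L j -> pt j p \in S -> eltdist j p a x r = eltdist j p b y r'.
  move=> zl zl' zz' j p le_p /zz'.
  by rewrite (dist_elt_located le_p zl) (dist_elt_located le_p zl').
have same_ends z z' a b x y r r' : located z a x r -> located z' b y r' -> same z z' ->
    minn (minn x m) (minn (x + r) m) = minn (minn y m) (minn (y + r') m) /\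
    minn (minn (L a - x) m) (minn (L a - (x + r)) m)
      = minn (minn (L b - y) m) (minn (L b - (y + r')) m).
  move=> zl zl' zz'; have eq_d := same_eltdist _ _ _ _ _ _ _ _ zl zl' zz'.
  have [le_x le_y] : x <= L a /\ y <= L b.
    by case: zl zl' => le_x _ [le_y _]; split; apply: leq_trans (leq_addr _ _) _; eassumption.
  have := eq_d a (L a) (leqnn _); have := eq_d a 0 isT; rewrite ptL /eltdist.
  rewrite !ptdist_u !ptdist_v //; first by move=> /(_ uS) Eu /(_ vS) Ev.
  - by case: zl'.
  - by case: zl.
have same_path z z' a x y r r' : located z a x r -> located z' a y r' -> same z z' -> z = z'.
  move=> zl zl' zz'; have [Eu Ev] := same_ends _ _ _ _ _ _ _ _ zl zl' zz'.
  have [[le_x _] [le_y _]] := (zl, zl').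
  have [eq_x eq_r] : x = y /\ r = r'; last by subst; apply: located_inj zl zl'.
  apply: sensors_along Eu Ev _; rewrite ?L_bounds //.
  have [->|neq_ak] := eqVneq a k; [by left | right].
  have := same_eltdist _ _ _ _ _ _ _ _ zl zl' zz' a 1 (ltnW (L_gt1 a neq_ak)) (wS a neq_ak).
  by rewrite /eltdist !ptdist_along ?L_gt1 // ?(leq_trans (leq_addr _ _) le_x)
    ?(leq_trans (leq_addr _ _) le_y).
have two_paths z z' a b x y r r' : a != k -> a != b ->
    located z a x r -> located z' b y r' -> same z z' -> z = z'.
  move=> neq_ak neq_ab zl zl' zz'; have [Eu Ev] := same_ends _ _ _ _ _ _ _ _ zl zl' zz'.
  have [[le_x _] [le_y _]] := (zl, zl').
  have a1 : 0 < 1 < L a by rewrite L_gt1.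
  have := same_eltdist _ _ _ _ _ _ _ _ zl zl' zz' a 1 (ltnW (L_gt1 a neq_ak)) (wS a neq_ak).
  rewrite /eltdist !(ptdist_around _ a1 neq_ab) !ptdist_along //; last first.
    exact: leq_trans (leq_addr _ _) le_x.
  case/(sensors_around m_gt0 (L_bounds a) (L_gt1 a neq_ak) (L_bounds b) le_x le_y Eu Ev).
  move=> r0 x_end; rewrite r0 in zl.
  have [l zl_b] := located_ends b zl x_end.
  exact: same_path zl_b zl' zz'.
apply/forallP=> z; apply/forallP=> z'; apply/implyP; apply: contraNT.
move=> /exists_inPn eq_d; apply/eqP.
have {eq_d} zz' : same z z' by move=> s /eq_d; rewrite negbK => /eqP.
have [a [x [r zl]]] := located_surj z; have [b [y [r' zl']]] := located_surj z'.
have [eq_ab|neq_ab] := eqVneq a b; first by subst b; apply: same_path zl zl' zz'.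
have [eq_ak|neq_ak] := eqVneq a k; last exact: two_paths neq_ak neq_ab zl zl' zz'.
have neq_bk : b != k by rewrite -eq_ak eq_sym.
apply/esym; apply: (two_paths _ _ _ _ _ _ _ _ neq_bk _ zl' zl); first by rewrite eq_sym.
by move=> s /zz'.
Qed.

(** * No generator with three elements *)

Lemma generator_separates (S : {set T}) (z z' : element e) :
  mixed_metric_generator e S -> z != z' ->
  exists2 s, s \in S & dist_elt s z != dist_elt s z'.
Proof. by move=> /forallP/(_ z)/forallP/(_ z')/implyP gen /gen/exists_inP. Qed.

(** The edge between two consecutive vertices has to be told from each of
    them. *)
Lemma generator_directions (S : {set T}) i k : mixed_metric_generator e S -> k < L i ->
  (exists2 s, s \in S & dist e s (pt i k.+1) < dist e s (pt i k)) /\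
  (exists2 s, s \in S & dist e s (pt i k) < dist e s (pt i k.+1)).
Proof.
move=> gen lt_k; have le_k := ltnW lt_k.
have edgeE s : dist_elt s (edge_elt lt_k) = minn (dist e s (pt i k)) (dist e s (pt i k.+1)).
  have [j [p [le_p ->]]] := pt_surj s.
  by rewrite (dist_elt_located le_p (located_edge lt_k)) /eltdist addn1 !dist_pt.
have [s sS] := @generator_separates S (inl (pt i k)) (edge_elt lt_k) gen isT.
have [s' sS'] := @generator_separates S (inl (pt i k.+1)) (edge_elt lt_k) gen isT.
by rewrite !edgeE /= => neq' neq; split; [exists s | exists s'] => //; lia.
Qed.

Definition meets (S : {set T}) i := [exists p : 'I_(L i), (0 < p) && (pt i p \in S)].

Lemma meetsP (S : {set T}) i :
  reflect (exists p, 0 < p < L i /\ pt i p \in S) (meets S i).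
Proof.
apply: (iffP existsP) => [[p /andP[p_gt0 pS]]|[p [/andP[p_gt0 lt_p] pS]]].
  by exists p; rewrite p_gt0 ltn_ord.
by exists (Ordinal lt_p); rewrite p_gt0.
Qed.

Lemma sensor_cases (S : {set T}) s i : ~~ meets S i -> s \in S ->
  [\/ s = u, s = v | exists j p, [/\ j != i, 0 < p < L j & s = pt j p]].
Proof.
move=> miss; have [j [p [le_p ->]]] := pt_surj s => pS.
have [->|p_gt0] := posnP p; first by constructor 1.
have [->|neq_p] := eqVneq p (L j); first by constructor 2; rewrite ptL.
have p_in : 0 < p < L j by rewrite p_gt0 ltn_neqAle neq_p.
constructor 3; exists j, p; split=> //.
by apply: contraNneq miss => eq_ji; subst j; apply/meetsP; exists p.
Qed.

(** For a sensor inside another path, the first edge of path [i] is never on a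
    shortest way from [u] to it: by balance, going along path [i] and back from
    [v] is longer than going along the other path.  So only [v] is left as a sensor for this edge, and then the
    path is shortest; likewise only [u] is left for its last edge at [v]. *)
Lemma generator_misses_path (S : {set T}) i : mixed_metric_generator e S -> ~~ meets S i ->
  [/\ u \in S, v \in S & L i = m].
Proof.
move=> gen miss; have Bi := L_bounds i; have Li := length_gt0 i.
have du k : k <= L i -> dist e u (pt i k) = minn k m.
  by move=> le_k; rewrite -(pt0 i) dist_pt // ptdist_u.
have dv k : k <= L i -> dist e v (pt i k) = minn (L i - k) m.
  by move=> le_k; rewrite -{1}(ptL i) dist_pt // ptdist_v.
have [[s sS lt_d] _] := generator_directions gen Li.
have [sE Lim] : s = v /\ L i = m.
  case: (sensor_cases miss sS) lt_d => [->|->|[j [p [neq_ji p_in ->]]]].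
  - by rewrite !du //; lia.
  - by rewrite !dv //; split=> //; lia.
  - have le_p : p <= L j by case/andP: p_in => _ /ltnW.
    rewrite !dist_pt // !ptdist_around // => /around_up.
    by case/andP: p_in => p_gt0 lt_p /(_ lt_p Li); have := L_bounds j; lia.
have lt_L : (L i).-1 < L i by rewrite prednK.
have [_ [s' sS' lt_d']] := generator_directions gen lt_L.
have sE' : s' = u.
  case: (sensor_cases miss sS') lt_d' => [->|->|[j [p [neq_ji p_in ->]]]] //.
    by rewrite prednK // !dv ?leq_pred //; lia.
  have le_p : p <= L j by case/andP: p_in => _ /ltnW.
  rewrite !dist_pt ?leq_pred // !ptdist_around // => /around_down.
  by case/andP: p_in => p_gt0 lt_p /(_ lt_p lt_L); have := L_bounds j; lia.
by split; rewrite -?sE' -?sE.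
Qed.

Lemma generator_meets_paths (S : {set T}) :
  mixed_metric_generator e S -> #|S| <= 3 -> forall i, meets S i.
Proof.
move=> gen le_S3 i; apply: contraT => miss_i.
have [uS vS Lim] := generator_misses_path gen miss_i.
have [k neq_ik miss_k] : exists2 k, i != k & ~~ meets S k.
  pose j1 := lift i (@ord0 1); pose j2 := lift i (@ord_max 1).
  have neq12 : j1 != j2 by rewrite (inj_eq lift_inj).
  have [/meetsP[p1 [lt_p1 p1S]]|] := boolP (meets S j1); last first.
    by move=> miss1; exists j1; first exact: neq_lift.
  have [/meetsP[p2 [lt_p2 p2S]]|] := boolP (meets S j2); last first.
    by move=> miss2; exists j2; first exact: neq_lift.
  have: size [:: u; v; pt j1 p1; pt j2 p2] <= #|S|.
    apply: uniq_leq_card => [|x]; last by rewrite !inE => /or4P[]/eqP->.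
    have [neq1u neq1v] := inner_neq lt_p1; have [neq2u neq2v] := inner_neq lt_p2.
    rewrite /= !inE !negb_or (theta_neq theta) ![u == _]eq_sym ![v == _]eq_sym.
    rewrite neq1u neq1v neq2u neq2v /= andbT pt_neq //.
    by case/andP: lt_p2 => _ /ltnW.
  by rewrite leqNgt ltnS le_S3.
have [_ _ Lkm] := generator_misses_path gen miss_k.
have m_gt1 : 1 < m.
  have := length_gt0 i; rewrite Lim leq_eqVlt => /predU1P[m1|//].
  have eq_ik : i = k by apply: length1_uniq; rewrite ?Lim ?Lkm.
  by rewrite eq_ik eqxx in neq_ik.
(* The symmetry exchanging paths [i] and [k] fixes all sensors. *)
have [|s sS] := @generator_separates S (inl (pt i 1)) (inl (pt k 1)) gen.
  by apply/eqP=> -[]/eqP; apply/negP/pt_neq; rewrite ?Lim ?Lkm // ltnW.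
have [le_i1 le_k1] : 1 <= L i /\ 1 <= L k by rewrite !length_gt0.
case: (sensor_cases miss_i sS) => [sE|sE|[j [p [neq_ji p_in sE]]]] /=; subst s.
- by rewrite -(pt0 i) !dist_pt // !ptdist_u eqxx.
- by rewrite -(ptL i) !dist_pt // !ptdist_v // Lim Lkm eqxx.
have neq_jk : j != k.
  by apply: contraNneq miss_k => eq_jk; subst j; apply/meetsP; exists p.
have le_p : p <= L j by case/andP: p_in => _ /ltnW.
by rewrite !dist_pt // !ptdist_around // Lim Lkm eqxx.
Qed.

Lemma generator_card_gt3 (S : {set T}) : mixed_metric_generator e S -> 3 < #|S|.
Proof.
move=> gen; rewrite ltnNge; apply/negP=> le_S3.
have p_ex i : exists q, 0 < q < L i /\ pt i q \in S.
  by apply/meetsP; apply: generator_meets_paths.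
have [p p_in] := fin_all_exists p_ex.
(* Sorting by the offsets [2 * p i - L i], shifted to avoid truncation. *)
have [a [b [c [abc]]]] := sort3 (fun i => (p i).*2 + (m.+1 - L i)).
have [[[pa paS] [pb pbS]] [pc pcS]] := (p_in a, p_in b, p_in c).
have [[/andP[pa0 paL] /andP[pb0 pbL]] /andP[pc0 pcL]] := (pa, pb, pc).
have [[le_pa le_pb] le_pc] := (ltnW paL, ltnW pbL, ltnW pcL).
have [[Ba Bb] Bc] := (L_bounds a, L_bounds b, L_bounds c).
move: (abc); rewrite /= !inE negb_or andbT => /andP[/andP[neq_ab neq_ac] neq_bc].
have [neq_ba neq_ca neq_cb] : [/\ b != a, c != a & c != b].
  by split; rewrite eq_sym.
have SE s : s \in S -> [\/ s = pt a (p a), s = pt b (p b) | s = pt c (p c)].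
  move=> sS; have [|neq_sa] := eqVneq s (pt a (p a)); first by constructor 1.
  have [|neq_sb] := eqVneq s (pt b (p b)); first by constructor 2.
  have [|neq_sc] := eqVneq s (pt c (p c)); first by constructor 3.
  have: size [:: s; pt a (p a); pt b (p b); pt c (p c)] <= #|S|.
    apply: uniq_leq_card => [|x]; last by rewrite !inE => /or4P[]/eqP->.
    by rewrite /= !inE !negb_or neq_sa neq_sb neq_sc /= !pt_neq.
  by rewrite leqNgt ltnS le_S3.
move=> le_ab le_bc.
(* The edge at the sensor of [a] towards [v] leads to the sensor of [b] or of
   [c]; this one and the sensor of [a] have offsets with a nonnegative sum, and
   the offset of [c] is the largest. *)
have le_ac : L a + L c <= (p a).*2 + (p c).*2.
  have [[s /SE sE lt_d] _] := generator_directions gen paL; move: lt_d.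
  case: sE => ->; rewrite !dist_pt //.
  - by rewrite !ptdist_along // /along !subnn ltn0.
  - rewrite !ptdist_around // => /around_up/(_ pbL paL).
    by clear -Ba Bb Bc le_bc; lia.
  - by rewrite !ptdist_around // => /around_up/(_ pcL paL); rewrite addnC [_ + L a]addnC.
have ge_ac : (p a).*2 + (p c).*2 <= L a + L c.
  have pcL' : (p c).-1 < L c by rewrite prednK.
  have [_ [s /SE sE lt_d]] := generator_directions gen pcL'; move: lt_d.
  have le_pc' := ltnW pcL'.
  case: sE => ->; rewrite !dist_pt //.
  - rewrite !ptdist_around // => /around_down/(_ paL pcL').
    by rewrite prednK // addnC [L c + _]addnC.
  - rewrite !ptdist_around // => /around_down/(_ pbL pcL'); rewrite prednK //.
    by clear -Ba Bb Bc le_ab; lia.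
  - by rewrite prednK // !ptdist_along // /along !subnn ltn0.
have Lca : L c = L a by clear -Ba Bc le_ac ge_ac; lia.
have eq_ac : p a + p c = L a by clear -Lca le_ac ge_ac; lia.
have {}le_ab : (p a).*2 + L b <= (p b).*2 + L a by clear -le_ab Ba Bb; lia.
have {}le_bc : (p b).*2 + L a <= (p c).*2 + L b by clear -le_bc Lca Ba Bb; lia.
have pc' : 0 < p c < L a by rewrite -Lca.
have [t [t' [r [lt_t t'_gt0 le_t' [Ea Eb Ec]]]]] :=
  mirror_pair Ba Bb pa pb pc' eq_ac le_ab le_bc.
rewrite -Lca in lt_t.
have le_tr := ltnW lt_t; have [z zl] := located_ex le_tr; have [z' zl'] := located_ex le_t'.
have neq_z : z != z'.
  by apply/eqP=> eq_z; rewrite -eq_z in zl'; apply: located_inner zl zl'.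
have [le_t le_t0] : t <= L c /\ t' <= L a.
  by split; apply: leq_trans (leq_addr r _) _.
have [s /SE sE /eqP[]] := generator_separates gen neq_z.
case: sE => ->; rewrite (dist_elt_located _ zl) // (dist_elt_located _ zl') // /eltdist.
- by rewrite !(ptdist_around _ pa neq_ac) !ptdist_along // Lca.
- by rewrite !(ptdist_around _ pb) // Lca.
- by rewrite !(ptdist_around _ pc neq_ca) !ptdist_along // Lca.
Qed.

Lemma theta_mdim : mdim e = 4.
Proof.
have [k Lk] := L_short.
pose S := u |: (v |: [set pt a 1 | a in [set~ k]]).
have gen : mixed_metric_generator e S.
  apply: (sensors_generate Lk); rewrite ?in_setU1 ?eqxx ?orbT // => a neq_ak.
  by rewrite !in_setU1 imset_f ?orbT // !inE.
have le_S4 : #|S| <= 4.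
  rewrite /S !cardsU1; have := leq_imset_card (fun a => pt a 1) [set~ k].
  by rewrite cardsC1 card_ord; lia.
apply/anti_leq/andP; split; first exact: leq_trans (bigminn_leq _ _ gen) le_S4.
apply: leq_bigminn => [|S' gen']; last exact: generator_card_gt3.
by apply: leq_trans (generator_card_gt3 gen) (max_card _).
Qed.

End Theta.

Theorem theorem7 (T : finType) (e : rel T) :
  simple_graph e -> connected_graph e -> balanced_theta_graph e ->
  mdim e = 4.
Proof.
move=> e_simple _ [u [v [P [theta balanced]]]].
have [k _ k_min] := arg_minnP (fun i => size (P i)) (isT : xpredT (@ord0 2)).
apply: (theta_mdim e_simple theta (m := size (P k))) => [i|]; last by exists k.
by rewrite k_min ?balanced.
Qed.
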